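(* Let $(M,W,P,Q)$ be a polygamous market (preferences are not required to be strict). Then every run of the algorithm PolyGS on $(M,W,P,Q)$, whatever choices are made whenever the algorithm leaves a choice open, terminates, and the matching $\mu$ it returns is valid (it satisfies all quotas, and no man and woman are matched to each other more than once) and stable.
   Context: **Market.** A polygamous market $(M,W,P,Q)$ consists of disjoint finite sets $M$ (men) and $W$ (women); for each person $p\in M\cup W$ a quota $q_p\in\mathbb{Z}_{\ge 0}$ (these form $Q$); and for each person a preference relation (these form $P$). The preference $P(m)$ of a man $m$ is a complete transitive relation (total preorder) $\geq_m$ on $W\cup\{m\}$, with associated indifference $=_m$ and strict preference $>_m$; the preference $P(w)$ of a woman $w$ is likewise a total preorder $\geq_w$ on $M\cup\{w\}$. Preferences are strict if indifference coincides with equality. Person $p_1$ is acceptable to $p$ if $p_1>_p p$. For a person $p_1$ and a finite (multi)set of persons $K$, write $p_1>_p K$ if there exists $\tau\in K$ with $p_1>_p\tau$. **Valid matching.** A (valid) matching is a set $\mu\subseteq M\times W$ (so each pair occurs at most once) with $|\mu(w)|\le q_w$ for all $w\in W$ and $|\mu(m)|\le q_m$ for all $m\in M$, where $\mu(w)=\{m\mid (m,w)\in\mu\}$ and $\mu(m)=\{w\mid (m,w)\in\mu\}$. By convention, $\mu(p)$ is then filled up with copies of $p$ to a multiset of size exactly $q_p$ (unused spots of $p$ count as $p$ matched to itself). **Stability.** Let $\mu(p)$ be filled up with copies of $p$ to a multiset of size exactly $q_p$, for every person $p$. Then $\mu$ is unstable if there is a pair $(m,w)\in (M\times W)\cup\{(m,m)\mid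 m\in M\}\cup\{(w,w)\mid w\in W\}$ such that ($m=w$ or $m\notin\mu(w)$), $w>_m\mu(m)$ and $m>_w\mu(w)$. Such a pair is called a blocking pair. $\mu$ is stable if it is not unstable. **Algorithm PolyGS (men propose).** The state is a multiset $\mu$ of pairs in $(M\times W)\cup\{(p,p)\mid p\in M\cup W\}$; during the run, $\mu(p)$ denotes the multiset of current partners of $p$ (including copies of $p$ coming from pairs $(p,p)$), not otherwise filled up. Initially $\mu$ contains $(w,w)$ exactly $q_w$ times for each $w\in W$ and nothing else. While there is a man $m$ with $|\mu(m)|<q_m$, choose any such $m$ and do the following. Let $w$ be a most preferred (according to $\geq_m$, ties broken arbitrarily) woman among those acceptable to $m$ to whom $m$ has not yet proposed; if there is no such woman, let $w=m$. If $w=m$, add one copy of $(m,m)$ to $\mu$. Otherwise $m$ proposes to $w$: if $m>_w\mu(w)$, let $m'$ be a least preferred element of $\mu(w)$ according to $\geq_w$ (possibly $w$ herself; ties broken arbitrarily), remove one copy of $(m',w)$ from $\mu$ and add $(m,w)$; if not $m>_w\mu(w)$, the proposal is rejected and $\mu$ is unchanged. When the loop ends, return $\mu$, whose man-woman pairs constitute the returned matching (self-pairs represent unused spots). *)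

(* Defs.v *)
(* MathComp, with multisets from mathcomp-finmap. *)
From mathcomp Require Import all_boot.
From mathcomp Require Import finmap multiset.

Set Implicit Arguments.
Unset Strict Implicit.
Unset Printing Implicit Defensive.

Local Open Scope mset_scope.
Local Open Scope nat_scope.

(* The disjoint union of the men (inl) and the women (inr). *)
Notation person M W := (M + W)%type.

(* The persons that p ranks: the other side, and p itself. *)
Definition ranked (M W : finType) (p : person M W) : pred (person M W) :=
  fun x => match p, x with
           | inl _, inr _ | inr _, inl _ => true
           | _, _ => x == p
           end.

(* [weakly_prefers p x y] is x >=_p y; its values outside [ranked p] are
   unconstrained and never used. Totality includes reflexivity. *)
Record market (M W : finType) := Market {
  quota : person M W -> nat;
  weakly_prefers : person M W -> rel (person M W);
  weakly_prefers_total :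
    forall p, {in ranked p &, total (weakly_prefers p)};
  weakly_prefers_trans :
    forall p, {in ranked p & &, transitive (weakly_prefers p)}
}.

Definition prefers (M W : finType) (K : market M W) (p x y : person M W) :
    bool :=
  weakly_prefers K p x y && ~~ weakly_prefers K p y x.

Definition acceptable (M W : finType) (K : market M W) (p x : person M W) :
    bool :=
  prefers K p x p.

(* x >_p A for a multiset A: x beats at least one element of A. *)
Definition prefers_to_some (M W : finType) (K : market M W)
    (p x : person M W) (A : {mset person M W}) : bool :=
  [exists y in A, prefers K p x y].

Definition wives (M W : finType) (mu : {set M * W}) (m : M) : {set W} :=
  [set w | (m, w) \in mu].

Definition husbands (M W : finType) (mu : {set M * W}) (w : W) : {set M} :=
  [set m | (m, w) \in mu].

Definition valid (M W : finType) (K : market M W) (mu : {set M * W}) : Prop :=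
  (forall w, #|husbands mu w| <= quota K (inr w)) /\
  (forall m, #|wives mu m| <= quota K (inl m)).

(* mu(p) filled up with copies of p to a multiset of size quota p (the
   truncated subtraction is exact for a valid mu). *)
Definition filled (M W : finType) (K : market M W) (mu : {set M * W})
    (p : person M W) : {mset person M W} :=
  match p with
  | inl m => seq_mset [seq (inr w : person M W) | w <- enum (wives mu m)]
               `+` msetn (quota K p - #|wives mu m|) p
  | inr w => seq_mset [seq (inl m : person M W) | m <- enum (husbands mu w)]
               `+` msetn (quota K p - #|husbands mu w|) p
  end.

(* (M x W) together with the diagonal of the set of persons. *)
Definition pair_domain (M W : finType) (a b : person M W) : bool :=
  match a, b with
  | inl _, inr _ => true
  | _, _ => a == b
  end.

Definition blocking_pair (M W : finType) (K : market M W) (mu : {set M * W})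
    (a b : person M W) : Prop :=
  [/\ pair_domain a b,
      a = b \/ a \notin filled K mu b,
      prefers_to_some K a b (filled K mu a) &
      prefers_to_some K b a (filled K mu b)].

Definition unstable (M W : finType) (K : market M W) (mu : {set M * W}) :
    Prop :=
  exists a b, blocking_pair K mu a b.

Definition stable (M W : finType) (K : market M W) (mu : {set M * W}) : Prop :=
  ~ unstable K mu.

(* The current multiset of pairs, and the proposals made so far. *)
Record state (M W : finType) := State {
  pairs : {mset person M W * person M W};
  proposals : {set M * W}
}.

(* The man is the first component of a mixed pair and the woman the second,
   so a self-pair (p, p) contributes exactly one copy of p. *)
Definition partners (M W : finType)
    (mu : {mset person M W * person M W}) (p : person M W) :
    {mset person M W} :=
  match p with
  | inl _ => seq_mset [seq e.2 | e <- mu & e.1 == p]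
  | inr _ => seq_mset [seq e.1 | e <- mu & e.2 == p]
  end.

Definition initial (M W : finType) (K : market M W) : state M W :=
  State
    (seq_mset (flatten
       [seq nseq (quota K (inr w)) (inr w : person M W, inr w : person M W)
       | w <- enum W]))
    set0.

(* The loop condition for a man m: |mu(m)| < q_m. *)
Definition free (M W : finType) (K : market M W) (s : state M W) (m : M) :
    bool :=
  size (partners (pairs s) (inl m)) < quota K (inl m).

Definition candidates (M W : finType) (K : market M W) (s : state M W)
    (m : M) : {set W} :=
  [set w | acceptable K (inl m) (inr w) & (m, w) \notin proposals s].

Definition best_candidate (M W : finType) (K : market M W) (s : state M W)
    (m : M) (w : W) : Prop :=
  w \in candidates K s m /\
  {in candidates K s m, forall w', weakly_prefers K (inl m) (inr w) (inr w')}.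

Definition least_preferred (M W : finType) (K : market M W)
    (p : person M W) (A : {mset person M W}) (x : person M W) : Prop :=
  x \in A /\ {in A, forall y, weakly_prefers K p y x}.

(* One iteration of the loop, for every possible resolution of the choices. *)
Inductive step (M W : finType) (K : market M W) (s : state M W) :
    state M W -> Prop :=
| StepSelf (m : M) :
    free K s m ->
    candidates K s m = set0 ->
    step K s (State ((inl m, inl m) +` pairs s) (proposals s))
| StepAccept (m : M) (w : W) (x : person M W) :
    free K s m ->
    best_candidate K s m w ->
    prefers_to_some K (inr w) (inl m) (partners (pairs s) (inr w)) ->
    least_preferred K (inr w) (partners (pairs s) (inr w)) x ->
    step K s (State ((inl m, inr w) +` (pairs s `\ (x, inr w)))
                    ((m, w) |: proposals s))
| StepReject (m : M) (w : W) :
    free K s m ->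
    best_candidate K s m w ->
    ~~ prefers_to_some K (inr w) (inl m) (partners (pairs s) (inr w)) ->
    step K s (State (pairs s) ((m, w) |: proposals s)).

Inductive reachable (M W : finType) (K : market M W) : state M W -> Prop :=
| ReachInit : reachable K (initial K)
| ReachStep (s s' : state M W) :
    reachable K s -> step K s s' -> reachable K s'.

Definition infinite_run (M W : finType) (K : market M W)
    (r : nat -> state M W) : Prop :=
  r 0 = initial K /\ forall i, step K (r i) (r i.+1).

(* A finite run that cannot be continued ends in a halted state. *)
Definition halted (M W : finType) (K : market M W) (s : state M W) : Prop :=
  reachable K s /\ forall s', ~ step K s s'.

Definition loop_ended (M W : finType) (K : market M W) (s : state M W) :
    Prop :=
  forall m, ~~ free K s m.

Definition couples (M W : finType)
    (mu : {mset person M W * person M W}) : {set M * W} :=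
  [set e | (inl e.1, inr e.2) \in mu].

(* Main.v *)
(* During a run a woman's partners only improve, so a man she has rejected or
   dropped never again beats any of her current partners; and a man proposes in
   decreasing order of preference. Hence when the loop has ended, a man who
   prefers w to one of his partners has already proposed to w, so w prefers him
   to none of hers. Each iteration adds a new proposal or a new self-pair of a
   man, which bounds the length of a run. *)
Require Import Defs.
From mathcomp Require Import all_boot.
From mathcomp Require Import finmap multiset.

Set Implicit Arguments.
Unset Strict Implicit.
Unset Printing Implicit Defensive.

Local Open Scope mset_scope.
Local Open Scope nat_scope.

(** * Sizes of multisets and greatest elements of lists *)

Lemma size_msetD (T : choiceType) (A B : {mset T}) :
  size (A `+` B) = size A + size B.
Proof.
rewrite -size_cat; apply/perm_size/allP => x _ /=.
by rewrite count_cat !count_mem_mset msetE2.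
Qed.

Lemma size_mset1D (T : choiceType) (a : T) (A : {mset T}) :
  size (a +` A) = (size A).+1.
Proof. by rewrite size_msetD enum_msetn. Qed.

Lemma leq_size_msetB1 (T : choiceType) (a : T) (A : {mset T}) :
  size (A `\ a) <= size A.
Proof.
have [aA|/mem_msetD1->//] := boolP (a \in A).
by rewrite -{2}(msetB1K aA) size_mset1D.
Qed.

(** The head is compared with a greatest element of the tail. Totality and transitivity are asked
    only on [P], because [weakly_prefers] is constrained only on [ranked]. The reversed relation
    yields least preferred partners. *)
Lemma exists_greatest (T : eqType) (P : {pred T}) (R : rel T) (s : seq T) :
  {in P &, total R} -> {in P & &, transitive R} -> all [in P] s -> s != [::] ->
  exists2 x, x \in s & {in s, forall y, R x y}.
Proof.
move=> Rtot Rtr; elim: s => // a s IHs /= /andP[Pa Ps] _.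
have Raa : R a a by have := Rtot a a Pa Pa; rewrite orbb.
have [->|s_n0] := eqVneq s [::].
  by exists a; rewrite ?mem_head // => y; rewrite inE => /eqP->.
have [x xs xmax] := IHs Ps s_n0; have Px := allP Ps x xs.
case/orP: (Rtot a x Pa Px) => [Rax|Rxa].
  exists a; rewrite ?mem_head // => y; rewrite inE => /predU1P[->//|ys].
  exact: Rtr (Px) (Pa) (allP Ps y ys) Rax (xmax y ys).
exists x; first by rewrite inE xs orbT.
by move=> y; rewrite inE => /predU1P[->//|/xmax].
Qed.

Section PolyGS.

Variables (M W : finType) (K : market M W).
Implicit Types (m : M) (w : W) (p x y : person M W) (s : state M W).
Local Arguments partners : simpl never.
Local Arguments candidates : simpl never.
Implicit Types (mu : {mset person M W * person M W}).

(** * Multiplicities of partners, and their change when a pair is added or removed *)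

Lemma partners_inlE mu m x : partners mu (inl m) x = mu (inl m, x).
Proof.
rewrite mset_seqE count_map count_filter -count_mem_mset.
by apply: eq_count => -[a b] /=; rewrite xpair_eqE andbC.
Qed.

Lemma partners_inrE mu w x : partners mu (inr w) x = mu (x, inr w).
Proof.
rewrite mset_seqE count_map count_filter -count_mem_mset.
by apply: eq_count => -[a b] /=; rewrite xpair_eqE.
Qed.

Lemma in_partners_inl mu m x :
  (x \in partners mu (inl m)) = ((inl m, x) \in mu).
Proof. by rewrite !in_mset partners_inlE. Qed.

Lemma in_partners_inr mu w x :
  (x \in partners mu (inr w)) = ((x, inr w) \in mu).
Proof. by rewrite !in_mset partners_inrE. Qed.

Lemma partners_inlD1 mu a x m :
  partners ((a, x) +` mu) (inl m) =
  if a == inl m then x +` partners mu (inl m) else partners mu (inl m).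
Proof.
apply/msetP => y; rewrite partners_inlE mset1DE xpair_eqE (eq_sym _ a).
by case: eqP => _ /=; rewrite ?mset1DE partners_inlE.
Qed.

Lemma partners_inrD1 mu x b w :
  partners ((x, b) +` mu) (inr w) =
  if b == inr w then x +` partners mu (inr w) else partners mu (inr w).
Proof.
apply/msetP => y; rewrite partners_inrE mset1DE xpair_eqE (eq_sym _ b) andbC.
by case: eqP => _ /=; rewrite ?mset1DE partners_inrE.
Qed.

Lemma partners_inlB1 mu a x m :
  partners (mu `\ (a, x)) (inl m) =
  if a == inl m then partners mu (inl m) `\ x else partners mu (inl m).
Proof.
apply/msetP => y; rewrite partners_inlE msetB1E xpair_eqE (eq_sym _ a).
by case: eqP => _ /=; rewrite ?msetB1E partners_inlE ?subn0.
Qed.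

Lemma partners_inrB1 mu x b w :
  partners (mu `\ (x, b)) (inr w) =
  if b == inr w then partners mu (inr w) `\ x else partners mu (inr w).
Proof.
apply/msetP => y; rewrite partners_inrE msetB1E xpair_eqE (eq_sym _ b) andbC.
by case: eqP => _ /=; rewrite ?msetB1E partners_inrE ?subn0.
Qed.

(** * Preferences on ranked persons *)

Lemma weakly_prefers_refl p x : ranked p x -> weakly_prefers K p x x.
Proof.
by move=> px; have := @weakly_prefers_total _ _ K p x x px px; rewrite orbb.
Qed.

Lemma prefers_to_someP p x (A : {mset person M W}) :
  reflect (exists2 y, y \in A & prefers K p x y) (prefers_to_some K p x A).
Proof. exact: exists_inP. Qed.

Lemma prefers_trans_weak p x y z : ranked p x -> ranked p y -> ranked p z ->
  prefers K p x y -> weakly_prefers K p y z -> prefers K p x z.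
Proof.
move=> px py pz /andP[xy yx] yz; apply/andP; split.
  exact: (@weakly_prefers_trans _ _ K p y x z).
by apply: contraNN yx => zx; apply: (@weakly_prefers_trans _ _ K p z y x).
Qed.

(** * The loop invariant and its preservation *)

(** A woman starts full of copies of herself and only exchanges partners, hence the equality in
    [size_partners_inr]. The boolean bound in [pairs_proposed] says both that a couple occurs at
    most once and that it comes from a proposal. [rejected_worst] covers men refused at once and men
    dropped later alike. *)
Record invariant s : Prop := Invariant {
  pairs_in_domain : forall a b, (a, b) \in pairs s -> pair_domain a b;
  size_partners_inl : forall m,
    size (partners (pairs s) (inl m)) <= quota K (inl m);
  size_partners_inr : forall w,
    size (partners (pairs s) (inr w)) = quota K (inr w);
  pairs_proposed : forall m w,
    pairs s (inl m, inr w) <= ((m, w) \in proposals s);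
  proposals_acceptable : forall m w,
    (m, w) \in proposals s -> acceptable K (inl m) (inr w);
  proposals_in_order : forall m w, (m, w) \in proposals s ->
    {in candidates K s m, forall w', weakly_prefers K (inl m) (inr w) (inr w')};
  self_exhausted : forall m,
    (inl m, inl m) \in pairs s -> candidates K s m = set0;
  partners_weakly_acceptable : forall w,
    {in partners (pairs s) (inr w),
       forall x, weakly_prefers K (inr w) x (inr w)};
  rejected_worst : forall m w, (m, w) \in proposals s ->
    (inl m, inr w) \notin pairs s ->
    {in partners (pairs s) (inr w),
       forall x, weakly_prefers K (inr w) x (inl m)}
}.

Lemma partners_ranked s p x :
  invariant s -> x \in partners (pairs s) p -> ranked p x.
Proof.
move=> /pairs_in_domain dom; case: p => [m|w].
  by rewrite in_partners_inl => /dom; case: x => //= m'; rewrite eq_sym.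
by rewrite in_partners_inr => /dom; case: x.
Qed.

Lemma initial_pairsE x y :
  pairs (initial K) (x, y) =
  if x is inr w then (if y == inr w then quota K (inr w) else 0) else 0.
Proof.
rewrite /= mset_seqE count_flatten sumn_map big_map big_enum /=.
case: x => [m|w].
  by apply: big1 => w _; rewrite count_nseq.
rewrite (bigD1 w) //= count_nseq /= xpair_eqE eqxx (eq_sym y) /= big1 ?addn0.
  by case: eqP; rewrite ?mul1n.
by move=> w' ww'; rewrite count_nseq /= xpair_eqE [_ == inr w](negPf ww').
Qed.

Lemma invariant_initial : invariant (initial K).
Proof.
have partners_w w : partners (pairs (initial K)) (inr w)
    = msetn (quota K (inr w)) (inr w).
  apply/msetP => x; rewrite partners_inrE initial_pairsE msetnE.
  by case: x => [//|w']; rewrite eq_sym; case: eqP => // -[->].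
split=> [a b|m|w|m w|m w|m w|m|w x|m w].
- rewrite in_mset initial_pairsE; case: a => // w /=.
  by rewrite eq_sym; case: eqP.
- suff -> : partners (pairs (initial K)) (inl m) = mset0 by rewrite size_mset0.
  by apply/msetP => x; rewrite partners_inlE initial_pairsE mset0E.
- by rewrite partners_w enum_msetn size_nseq.
- by rewrite initial_pairsE.
- by rewrite inE.
- by rewrite inE.
- by rewrite in_mset initial_pairsE.
- rewrite partners_w in_msetn => /andP[_ /eqP->].
  by apply: weakly_prefers_refl; rewrite /ranked.
- by rewrite inE.
Qed.


Lemma candidatesS s s' m :
  proposals s \subset proposals s' ->
  candidates K s' m \subset candidates K s m.
Proof.
move=> ss'; apply/subsetP => w; rewrite !inE => /andP[-> /=].
exact/contraNN/(subsetP ss').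
Qed.

(** Acceptance and rejection record the proposal in the same way, so the fields about [proposals]
    alone are treated once. The new woman is best among the candidates, and for older proposals the
    candidate sets only shrink. *)
Lemma proposal_invariant s s' m w :
    invariant s -> best_candidate K s m w ->
    proposals s' = (m, w) |: proposals s ->
  (forall m' w', (m', w') \in proposals s' ->
     acceptable K (inl m') (inr w')) /\
  (forall m' w', (m', w') \in proposals s' ->
     {in candidates K s' m',
       forall v, weakly_prefers K (inl m') (inr w') (inr v)}).
Proof.
move=> inv [wc wbest] Ps'.
have sub m' : candidates K s' m' \subset candidates K s m'.
  by apply: candidatesS; rewrite Ps' subsetUr.
split=> m' w'; rewrite Ps' in_setU1 => /predU1P[[-> ->]|Pm'w'].
- by move: wc; rewrite inE => /andP[].
- exact: proposals_acceptable inv _ _ Pm'w'.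
- by move=> v /(subsetP (sub m)) /wbest.
- by move=> v /(subsetP (sub m')); apply: (proposals_in_order inv).
Qed.

Lemma invariant_self s m :
  invariant s -> free K s m -> candidates K s m = set0 ->
  invariant (State ((inl m, inl m) +` pairs s) (proposals s)).
Proof.
move=> inv fm cm0; have [dom szl szr prop acc order self wacc rej] := inv.
split=> //= [a b|m'|w|m' w|m'|w|m' w].
- by rewrite in_mset1D => /predU1P[[-> ->]|/dom//]; rewrite /= eqxx.
- by rewrite partners_inlD1; case: eqP => [[<-]|//]; rewrite size_mset1D.
- by rewrite partners_inrD1; apply: szr.
- by rewrite mset1DE xpair_eqE andbF; apply: prop.
- by rewrite in_mset1D => /predU1P[[->]|/self].
- by rewrite partners_inrD1 => x; apply: wacc.
- rewrite partners_inrD1 in_mset1D negb_or => Pm' /andP[_ nm'] x.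
  exact: rej.
Qed.

Lemma invariant_reject s m w :
    invariant s -> best_candidate K s m w ->
    ~~ prefers_to_some K (inr w) (inl m) (partners (pairs s) (inr w)) ->
  invariant (State (pairs s) ((m, w) |: proposals s)).
Proof.
move=> inv best npref; set s' := State _ _.
have [acc' order'] := @proposal_invariant s s' m w inv best erefl.
have [dom szl szr prop _ _ self wacc rej] := inv.
split=> //= [m' w'|m' /self cm'0|m' w'].
- apply: leq_trans (prop m' w') _.
  by rewrite in_setU1; case: in_mem; rewrite ?orbT.
- by apply/eqP; rewrite -subset0 -cm'0 candidatesS ?subsetUr.
- rewrite in_setU1 => /predU1P[[-> ->] _ x xw|]; last exact: rej.
  have rx : ranked (inr w) x := partners_ranked inv xw.
  (* If [x] were not at least as good as [m], totality would make [m] strictly better than [x], and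
     the proposal would have been accepted. *)
  apply: contraNT npref => nxm; apply/prefers_to_someP; exists x => //.
  have := @weakly_prefers_total _ _ K (inr w) (inl m) x isT rx.
  by rewrite /prefers (negPf nxm) orbF andbT; apply.
Qed.

(** The newcomer [m] beats some current partner [z], so every lower bound known for [z] passes to
    [m] by transitivity; the partners that stay keep their own bounds. *)
Lemma invariant_accept s m w x :
    invariant s -> free K s m -> best_candidate K s m w ->
    prefers_to_some K (inr w) (inl m) (partners (pairs s) (inr w)) ->
    least_preferred K (inr w) (partners (pairs s) (inr w)) x ->
  invariant (State ((inl m, inr w) +` (pairs s `\ (x, inr w)))
                   ((m, w) |: proposals s)).
Proof.
move=> inv fm best /prefers_to_someP[z zw mz] [xw xleast]; set s' := State _ _.
have [acc' order'] := @proposal_invariant s s' m w inv best erefl.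
have [dom szl szr prop _ _ self wacc rej] := inv.
have rkw y : y \in partners (pairs s) (inr w) -> ranked (inr w) y.
  exact: partners_ranked.
have rww : ranked (inr w : person M W) (inr w) by rewrite /ranked.
have wwE (w' : W) : (inr w == inr w' :> person M W) = (w == w') by [].
have mmE (m' : M) : (inl m == inl m' :> person M W) = (m == m') by [].
have old e : e \in pairs s `\ (x, inr w) -> e \in pairs s.
  by rewrite in_msetB1 => /andP[].
have Pmw : (m, w) \notin proposals s by case: best; rewrite inE => /andP[].
have partners_w w' : partners (pairs s') (inr w') =
    if w == w' then inl m +` (partners (pairs s) (inr w') `\ x)
    else partners (pairs s) (inr w').
  by rewrite partners_inrD1 partners_inrB1 wwE; case: eqP.
split=> //= [a b|m'|w'|m' w'|m'|w' y|m' w'].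
- by rewrite in_mset1D => /predU1P[[-> ->]//|/old/dom].
(* The dropped [x] may be [m'], another man or [w] herself, so only an inequality holds; freeness of
   [m] leaves room for his new pair. *)
- have sA : size (partners (pairs s `\ (x, inr w)) (inl m'))
      <= size (partners (pairs s) (inl m')).
    by rewrite partners_inlB1; case: ifP; rewrite ?leq_size_msetB1.
  rewrite partners_inlD1 mmE.
  case: eqP => [mm'|_]; last exact: leq_trans (szl m').
  by rewrite size_mset1D; apply: leq_ltn_trans sA _; rewrite -mm'.
- rewrite partners_w; case: eqP => [<-|//].
  by rewrite size_mset1D -(size_mset1D x) msetB1K.
- rewrite mset1DE msetB1E in_setU1.
  have -> : ((inl m', inr w') == (inl m, inr w) :> person M W * person M W)
      = ((m', w') == (m, w)) by [].
  case: eqP => [[-> ->]|_]; last exact: leq_trans (leq_subr _ _) (prop _ _).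
  (* A pair not yet proposed has multiplicity zero, so the added copy is the only one. *)
  have := prop m w; rewrite (negPf Pmw) leqn0 => /eqP->.
  by rewrite sub0n.
- rewrite in_mset1D => /predU1P[//|/old/self cm'0].
  by apply/eqP; rewrite -subset0 -cm'0 candidatesS ?subsetUr.
- rewrite partners_w; case: eqP => [<-|_ /wacc//].
  rewrite in_mset1D => /predU1P[->|].
    have /andP[mz' _] := mz.
    exact: weakly_prefers_trans (rkw z zw) _ rww mz' (wacc w z zw).
  by rewrite in_msetB1 => /andP[_ /wacc].
- move=> P' n' y; move: P' n'.
  rewrite -in_partners_inr partners_w in_setU1 => P'.
  case: (eqVneq w w') P' => [<-|ww']; last first.
    rewrite xpair_eqE (eq_sym w') (negPf ww') andbF /= in_partners_inr.
    by move=> P' n'; apply: rej.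
  rewrite xpair_eqE eqxx andbT in_mset1D negb_or => P' /andP[nm'm nm'].
  (* After the step [m] is matched to [w] and [m'] is not, so [m'] is not [m] and his proposal is an
     older one. *)
  have {}P' : (m', w) \in proposals s.
    by case/predU1P: P' nm'm => // ->; rewrite eqxx.
  (* If w still held m' before this step, then m' is the partner x that she
     drops, and x is a least preferred one. *)
  have worst t : t \in partners (pairs s) (inr w) ->
      weakly_prefers K (inr w) t (inl m').
    have [m'w|] := boolP (inl m' \in partners (pairs s) (inr w)).
      suff -> : inl m' = x by apply: xleast.
      by apply: contraNeq nm' => m'x; rewrite in_msetB1 m'w (negPf m'x).
    by rewrite in_partners_inr => nm'w; apply: rej.
  rewrite in_mset1D => /predU1P[->|].
    (* The chain is [m] over [z] over [m']. *)
    have /andP[mz' _] := mz.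
    exact: weakly_prefers_trans (rkw z zw) _ _ mz' (worst z zw).
  by rewrite in_msetB1 => /andP[_ /worst].
Qed.

Lemma invariant_step s s' : invariant s -> step K s s' -> invariant s'.
Proof.
move=> inv; case=> [m fm cm0|m w x fm best pref least|m w fm best npref].
- exact: invariant_self.
- exact: invariant_accept.
- exact: invariant_reject.
Qed.

Lemma invariant_reachable s : reachable K s -> invariant s.
Proof.
by elim=> [|s1 s2 _ inv1]; [apply: invariant_initial | apply: invariant_step].
Qed.

(** * Termination, and existence of a step while some man is free *)

(** Self-pairs of women are left out: acceptances may remove them and no step adds one. *)
Definition progress s : nat :=
  #|proposals s| + \sum_(m : M) pairs s (inl m, inl m).

Lemma progress_step s s' : step K s s' -> progress s < progress s'.
Proof.
have proposal m w : best_candidate K s m w ->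
    #|(m, w) |: proposals s| = #|proposals s|.+1.
  by case; rewrite inE => /andP[_ nP] _; rewrite cardsU1 nP.
rewrite /progress.
case=> [m _ _|m w x _ /proposal best _ _|m w _ /proposal best _] /=.
- rewrite ltn_add2l (bigD1 m) //= [ltnRHS](bigD1 m) //=.
  rewrite mset1DE eqxx add1n addSn ltnS leq_add2l leq_sum // => i _.
  by rewrite mset1DE leq_addl.
- rewrite best addSn ltnS leq_add2l leq_sum // => i _.
  by rewrite mset1DE msetB1E !xpair_eqE !andbF subn0.
- by rewrite best.
Qed.

(** Self-pairs of a man count among his partners, hence are bounded by his quota. *)
Lemma progress_bound s : invariant s ->
  progress s <= #|{: M * W}| + \sum_(m : M) quota K (inl m).
Proof.
move=> inv; rewrite leq_add ?max_card // leq_sum // => m _.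
apply: leq_trans (size_partners_inl inv m).
by rewrite -partners_inlE -count_mem_mset count_size.
Qed.

Lemma no_infinite_run (r : nat -> state M W) : ~ infinite_run K r.
Proof.
case=> r0 rS.
have reach i : reachable K (r i).
  by elim: i => [|i IHi]; [rewrite r0; left | apply: ReachStep IHi (rS i)].
have le_progress i : i <= progress (r i).
  by elim: i => // i IHi; apply: leq_ltn_trans IHi (progress_step (rS i)).
set b := #|{: M * W}| + \sum_(m : M) quota K (inl m).
(* Progress is at least [i] after [i] steps, so index [b.+1] already exceeds the bound [b]. *)
have inv := invariant_reachable (reach b.+1).
by have := leq_trans (le_progress b.+1) (progress_bound inv); rewrite ltnn.
Qed.

(** A free man always enables a step: a self-pair if he has no candidate, otherwise a proposal to a
    best one, which is either accepted or rejected. *)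
Lemma halted_loop_ended s : halted K s -> loop_ended K s.
Proof.
case=> /invariant_reachable inv nostep m; apply/negP => fm.
have [cm0|cm_n0] := eqVneq (candidates K s m) set0.
  exact: nostep (StepSelf fm cm0).
have [||||w wc wbest] := @exists_greatest W predT
  (fun w w' => weakly_prefers K (inl m) (inr w) (inr w'))
  (enum (candidates K s m)).
- by move=> w w' _ _; apply: weakly_prefers_total.
- by move=> w w' w'' _ _ _; apply: weakly_prefers_trans.
- exact/allP.
- by rewrite -size_eq0 -cardE cards_eq0.
have best : best_candidate K s m w.
  split; first by rewrite -mem_enum.
  by move=> w' w'c; apply: wbest; rewrite mem_enum.
have [pref|npref] := boolP
    (prefers_to_some K (inr w) (inl m) (partners (pairs s) (inr w))).
  (* The witness [z] shows that [w] has a partner at all, so a least preferred one exists. *)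
  have [z zw _] := prefers_to_someP _ _ _ pref.
  have [||||x xw xleast] := @exists_greatest _ (ranked (inr w))
    (fun x y => weakly_prefers K (inr w) y x) (partners (pairs s) (inr w)).
  - by move=> x y rx ry; rewrite orbC; apply: weakly_prefers_total.
  - move=> y x t ry rx rt xy yt; exact: weakly_prefers_trans yt xy.
  - by apply/allP => x; apply: partners_ranked.
  - by apply: contraTneq zw => p0; rewrite /in_mem /= p0.
  exact: nostep (StepAccept fm best pref (conj xw xleast)).
exact: nostep (StepReject fm best npref).
Qed.

(** * From the state to the returned matching *)

(** Couples have multiplicity at most one by [pairs_proposed], so counting women agrees with
    membership in a set; by [pairs_in_domain] the only man among the partners of [m] is [m]. *)
Lemma partners_wives s m : invariant s ->
  partners (pairs s) (inl m) =
    seq_mset [seq (inr w : person M W)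
             | w <- enum (wives (couples (pairs s)) m)]
      `+` msetn (pairs s (inl m, inl m)) (inl m).
Proof.
move=> inv; apply/msetP => x; rewrite partners_inlE msetE2 mset_seqE msetnE.
case: x => [m'|w].
  rewrite (count_memPn _) ?add0n; last by apply/mapP => -[].
  case: eqP => [[->]//|m'm]; apply/mset_eq0P.
  by apply: contra_notN m'm => /(pairs_in_domain inv)/eqP.
rewrite addn0 count_uniq_mem ?(map_inj_uniq inr_inj) ?enum_uniq //.
rewrite (mem_map inr_inj) mem_enum !inE /= in_mset.
by have := pairs_proposed inv m w; case: in_mem; case: (pairs s _) => [|[]].
Qed.

Lemma partners_husbands s w : invariant s ->
  partners (pairs s) (inr w) =
    seq_mset [seq (inl m : person M W)
             | m <- enum (husbands (couples (pairs s)) w)]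
      `+` msetn (pairs s (inr w, inr w)) (inr w).
Proof.
move=> inv; apply/msetP => x; rewrite partners_inrE msetE2 mset_seqE msetnE.
case: x => [m|w'].
  rewrite addn0 count_uniq_mem ?(map_inj_uniq inl_inj) ?enum_uniq //.
  rewrite (mem_map inl_inj) mem_enum !inE /= in_mset.
  by have := pairs_proposed inv m w; case: in_mem; case: (pairs s _) => [|[]].
rewrite (count_memPn _) ?add0n; last by apply/mapP => -[].
case: eqP => [[->]//|w'w]; apply/mset_eq0P.
by apply: contra_notN w'w => /(pairs_in_domain inv)/eqP.
Qed.

Lemma size_partners_wives s m : invariant s ->
  size (partners (pairs s) (inl m)) =
    #|wives (couples (pairs s)) m| + pairs s (inl m, inl m).
Proof.
move=> inv; rewrite partners_wives // size_msetD enum_msetn size_nseq.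
by rewrite (perm_size (perm_eq_seq_mset _)) size_map -cardE.
Qed.

Lemma size_partners_husbands s w : invariant s ->
  size (partners (pairs s) (inr w)) =
    #|husbands (couples (pairs s)) w| + pairs s (inr w, inr w).
Proof.
move=> inv; rewrite partners_husbands // size_msetD enum_msetn size_nseq.
by rewrite (perm_size (perm_eq_seq_mset _)) size_map -cardE.
Qed.

(** When all places of [p] are taken, the self-pairs number exactly the quota minus the couples,
    which is the padding used by [filled]. *)
Lemma filled_couples s p : invariant s ->
  size (partners (pairs s) p) = quota K p ->
  filled K (couples (pairs s)) p = partners (pairs s) p.
Proof.
case: p => [m|w] inv.
  by rewrite size_partners_wives // partners_wives //= => <-; rewrite addKn.
by rewrite size_partners_husbands // partners_husbands //= => <-; rewrite addKn.
Qed.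

(** * Validity and stability *)

Lemma valid_couples s : invariant s -> valid K (couples (pairs s)).
Proof.
move=> inv; split=> [w|m].
  by rewrite -(size_partners_inr inv) size_partners_husbands ?leq_addr.
apply: leq_trans (size_partners_inl inv m).
by rewrite size_partners_wives ?leq_addr.
Qed.

Lemma stable_couples s :
  invariant s -> loop_ended K s -> stable K (couples (pairs s)).
Proof.
move=> inv ended [a [b]].
(* Women are always full; men are full because the loop has ended. *)
have fill p : filled K (couples (pairs s)) p = partners (pairs s) p.
  apply: filled_couples => //; case: p => [m|w]; last exact: size_partners_inr.
  apply/eqP; rewrite eqn_leq size_partners_inl // leqNgt; exact: ended.
rewrite /blocking_pair !fill.
have partner_acc m w : inr w \in partners (pairs s) (inl m) ->
    (m, w) \in proposals s.
  rewrite in_partners_inl in_mset => mw.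
  by have := leq_trans mw (pairs_proposed inv m w); rewrite lt0b.
case: a b => [m|w] [m'|w'] //=.
(* Pair [(m, m)]: each partner of [m] is [m] himself or a woman he proposed to, hence acceptable, so
   he prefers himself to none of them. *)
- case=> /eqP[<-] _ /prefers_to_someP[[m1|w] mx mpref] _.
    have := partners_ranked inv mx => /eqP[m1m].
    by move: mpref; rewrite m1m /prefers andbN.
  have /andP[_ /negP[]] := proposals_acceptable inv (partner_acc _ _ mx).
  by case/andP: mpref.
- case=> _ [//|nmw] /prefers_to_someP[x xm mpref] /prefers_to_someP[y yw wpref].
  (* The partner [x] that [m] would give up is [m] or an acceptable woman, so anyone better than [x]
     is acceptable. *)
  have acc_w : acceptable K (inl m) (inr w').
    case: x xm mpref => [m1|w] xm mpref.
      by have := partners_ranked inv xm => /eqP[m1m]; rewrite m1m in mpref.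
    have /andP[wm _] := proposals_acceptable inv (partner_acc _ _ xm).
    by apply: prefers_trans_weak mpref wm => //; rewrite /ranked.
  (* Otherwise [w'] is still a candidate: [x = m] contradicts [self_exhausted], and a woman [x] was
     proposed to while [w'] was not, so [x] is at least as good as [w']. *)
  have Pmw : (m, w') \in proposals s.
    apply/negPn/negP => nP.
    have cw : w' \in candidates K s m by rewrite inE acc_w.
    case: x xm mpref => [m1|w] xm mpref.
      have := partners_ranked inv xm => /eqP[m1m]; rewrite m1m in xm.
      rewrite in_partners_inl in xm.
      by rewrite (self_exhausted inv xm) inE in cw.
    have := proposals_in_order inv (partner_acc _ _ xm) cw.
    by case/andP: mpref => _ /negP.
  rewrite in_partners_inr in nmw.
  have := rejected_worst inv Pmw nmw yw.
  by case/andP: wpref => _ /negP.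
(* A pair with the woman first lies outside [pair_domain]. *)
- by case.
- case=> /eqP[<-] _ /prefers_to_someP[x xw /andP[_ npref]] _.
  by case/negP: npref; apply: (partners_weakly_acceptable inv).
Qed.

End PolyGS.

Theorem proposition5 (M W : finType) (K : market M W) :
  (forall r : nat -> state M W, ~ infinite_run K r) /\
  (forall s : state M W, halted K s ->
     [/\ loop_ended K s,
         forall (m : M) (w : W), (pairs s (inl m, inr w) <= 1)%N,
         valid K (couples (pairs s)) &
         stable K (couples (pairs s))]).
Proof.
split; first exact: no_infinite_run.
move=> s hs; have ended := halted_loop_ended hs.
have inv : invariant K s by case: hs => /invariant_reachable.
split=> // [m w||].
- exact: leq_trans (pairs_proposed inv m w) (leq_b1 _).
- exact: valid_couples.
- exact: stable_couples.
Qed.
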